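(* For a monoid $A$ and an ideal $I$ of $A$, set $I^{Frob}:=\{x\in A\mid \exists\, n\in\mathbb{N}\text{ such that }x^n\in I^{[n]}\}$, where $I^{[n]}:=\{ax^n\mid a\in A,\ x\in I\}$. Then: (1) $I\mapsto I^{Frob}$ defines a closure operation on the collection of all ideals of $A$ (the Frobenius closure). (2) Frobenius closure is persistent on the category of all monoids and commutes with localization.
   Context: $\mathbb{N}=\{1,2,\ldots\}$. A monoid means a commutative monoid, written multiplicatively, with identity $1$ and a base point $0$ satisfying $0\cdot a=0$; morphisms preserve products, $1$ and $0$. An ideal $I\subseteq A$ is a subset containing $0$ with $IA\subseteq I$. A closure operation on the set of ideals of $A$ is a map $I\mapsto I^{cl}$ from this set to itself with $I\subseteq I^{cl}$; $I\subseteq J\Rightarrow I^{cl}\subseteq J^{cl}$; $(I^{cl})^{cl}=I^{cl}$. Let $cl$ be a closure operation defined on the ideals of all monoids in a subcategory $\mathcal{M}$ of the category of monoids. It is persistent on $\mathcal{M}$ if for every morphism $\phi:A\to B$ in $\mathcal{M}$ and every ideal $I$ of $A$, $\phi(I^{cl})B\subseteq(\phi(I)B)^{cl}$. A persistent $cl$ commutes with localization in $\mathcal{M}$ if for every $A\in\mathcal{M}$ and every multiplicative set $S\subseteq A$ such that the localization map $A\to S^{-1}A$ is in $\mathcal{M}$, $S^{-1}(I^{cl})=(S^{-1}I)^{cl}$ for every ideal $I$ of $A$. Here $S^{-1}A$ is the monoid of fractions $a/s$, with $a/s=b/t$ iff $uta=usb$ for some $u\in S$. *)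

(* Defs.v *)
From HB Require Import structures.
From mathcomp Require Import all_boot.
From mathcomp Require Import boolp classical_sets.

Set Implicit Arguments.
Unset Strict Implicit.
Unset Printing Implicit Defensive.

Import Algebra.
Local Open Scope classical_set_scope.
Local Open Scope quotient_scope.
Local Open Scope group_scope.

(* The zero monoid, in which 0 = 1, is allowed.  The choiceType structure     *)
(* inherited from monoidType is no restriction, by gen_choiceMixin.           *)
HB.mixin Record Monoid_isComMonoid0 A of Monoid A := {
  cmulC : commutative (@mul A);
  zero : A;
  cmul0l : left_zero zero (@mul A)
}.

#[short(type="comMonoid0Type")]
HB.structure Definition ComMonoid0 := {A of Monoid_isComMonoid0 A & Monoid A}.

Notation "0" := (@zero _) : group_scope.

HB.instance Definition _ (A : comMonoid0Type) :=
  Monoid.isComLaw.Build A 1 (@mul A) mulgA cmulC mul1g.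

Section Ideals.
Variable A : comMonoid0Type.
Implicit Types (I J : set A) (n : nat).

Definition is_ideal I := I 0 /\ forall x a, I x -> I (x * a).

Definition closure_operation (c : set A -> set A) :=
  [/\ forall I, is_ideal I -> is_ideal (c I),
      forall I, is_ideal I -> I `<=` c I,
      forall I J, is_ideal I -> is_ideal J -> I `<=` J -> c I `<=` c J
    & forall I, is_ideal I -> c (c I) = c I].

Definition frob_power I n : set A :=
  [set y | exists a x, I x /\ y = a * x ^+ n].

Definition frob_closure I : set A :=
  [set x | exists n, (0 < n)%N /\ frob_power I n (x ^+ n)].

End Ideals.

Definition monoid0_morphism (A B : comMonoid0Type) (f : A -> B) :=
  monoid_morphism f /\ f 0 = 0.

(* The set f(I)B. *)
Definition extend (A B : comMonoid0Type) (f : A -> B) (I : set A) : set B :=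
  [set y | exists x b, I x /\ y = f x * b].

Record mult_set (A : comMonoid0Type) := MultSet {
  mult_set_carrier :> A -> Prop;
  mult_set1 : mult_set_carrier 1;
  mult_setM : forall s t,
    mult_set_carrier s -> mult_set_carrier t -> mult_set_carrier (s * t)
}.

Section Localization.
Variables (A : comMonoid0Type) (S : mult_set A).

Definition denom := set_type (mult_set_carrier S).
HB.instance Definition _ := Choice.on denom.

Definition Denom (s : A) (Ss : S s) : denom := SigSub (mem_set Ss).
Definition denom_val (s : denom) : A := val s.

Lemma denomP (s : denom) : S (denom_val s).
Proof. exact: set_mem (valP s). Qed.

Definition denom1 : denom := Denom (mult_set1 S).
Definition denomM (s t : denom) : denom :=
  Denom (mult_setM (denomP s) (denomP t)).

Lemma denomME (s t : denom) : denom_val (denomM s t) = denom_val s * denom_val t.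
Proof. by []. Qed.

(* The pair (a, s) stands for the fraction a/s. *)
Definition frac_rel (p q : A * denom) : bool :=
  `[< exists u, S u /\ u * denom_val q.2 * p.1 = u * denom_val p.2 * q.1 >].

Lemma frac_relP (p q : A * denom) :
  reflect (exists u, S u /\ u * denom_val q.2 * p.1 = u * denom_val p.2 * q.1)
          (frac_rel p q).
Proof. exact: asboolP. Qed.

Lemma frac_rel_refl : reflexive frac_rel.
Proof. by move=> p; apply/frac_relP; exists 1; split=> //; exact: mult_set1. Qed.

Lemma frac_rel_sym : symmetric frac_rel.
Proof. by move=> p q; apply/frac_relP/frac_relP => -[u [Su e]]; exists u. Qed.

Lemma frac_rel_trans : transitive frac_rel.
Proof.
move=> [b t] [a s] [c r] /frac_relP[u [Su /= e]] /frac_relP[v [Sv /= e']].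
apply/frac_relP => /=; exists (u * v * denom_val t); split.
  by apply: mult_setM; [exact: mult_setM | exact: denomP].
rewrite [LHS](ACl ((2*4)*(1*3*5)))%AC /= e.
rewrite !mulgA [LHS](ACl ((3*4)*(1*2*5)))%AC /= e'.
by rewrite !mulgA [LHS](ACl (1*3*4*2*5))%AC.
Qed.

Canonical frac_equiv := EquivRel frac_rel frac_rel_refl frac_rel_sym frac_rel_trans.

Definition localization := {eq_quot frac_equiv}.
HB.instance Definition _ := EqQuotient.on localization.
HB.instance Definition _ := Choice.on localization.

Definition frac (a : A) (s : denom) : localization :=
  \pi_localization (a, s).

Lemma frac_eqP (a b : A) (s t : denom) :
  frac a s = frac b t <->
  exists u, S u /\ u * denom_val t * a = u * denom_val s * b.
Proof.
split=> [/eqmodP/frac_relP //|h]; apply/eqmodP; exact/frac_relP.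
Qed.

Lemma fracE (x : localization) : x = frac (repr x).1 (repr x).2.
Proof. by rewrite /frac -surjective_pairing reprK. Qed.

Definition frac_mul (x y : localization) : localization :=
  frac ((repr x).1 * (repr y).1) (denomM (repr x).2 (repr y).2).

Lemma frac_mulE (a b : A) (s t : denom) :
  frac_mul (frac a s) (frac b t) = frac (a * b) (denomM s t).
Proof.
rewrite /frac_mul.
have := fracE (frac a s); have := fracE (frac b t).
case: (repr (frac a s)) (repr (frac b t)) => [a' s'] [b' t'] /=.
move=> /frac_eqP[v [Sv ev]] /frac_eqP[u [Su eu]].
apply/frac_eqP; exists (u * v); split; first exact: mult_setM.
rewrite !denomME !mulgA [LHS](ACl ((1*3*5)*(2*4*6)))%AC /= -eu -ev.
by rewrite !mulgA [LHS](ACl (1*4*2*5*3*6))%AC.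
Qed.

Lemma frac_mulA : associative frac_mul.
Proof.
move=> x y z; rewrite (fracE x) (fracE y) (fracE z) !frac_mulE mulgA.
by congr frac; apply: val_inj; rewrite /= mulgA.
Qed.

Lemma frac_mulC : commutative frac_mul.
Proof.
move=> x y; rewrite (fracE x) (fracE y) !frac_mulE cmulC.
by congr frac; apply: val_inj; rewrite /= cmulC.
Qed.

Lemma frac_mul1 : left_id (frac 1 denom1) frac_mul.
Proof.
move=> x; rewrite (fracE x) frac_mulE mul1g.
by congr frac; apply: val_inj; rewrite /= mul1g.
Qed.

Lemma frac_mulr1 : right_id (frac 1 denom1) frac_mul.
Proof. by move=> x; rewrite frac_mulC frac_mul1. Qed.

Lemma frac_mul0 : left_zero (frac 0 denom1) frac_mul.
Proof.
move=> x; rewrite (fracE x) frac_mulE cmul0l; apply/frac_eqP.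
by exists 1; split; [exact: mult_set1 | rewrite !(cmulC _ 0) !cmul0l].
Qed.

HB.instance Definition _ := isMonoid.Build localization
  frac_mulA frac_mul1 frac_mulr1.
HB.instance Definition _ := Monoid_isComMonoid0.Build localization
  frac_mulC frac_mul0.

Definition localization_map (a : A) : localization := frac a denom1.

Lemma localization_map_morphism : monoid0_morphism localization_map.
Proof.
split=> //; split=> // x y; rewrite /localization_map [RHS]frac_mulE.
by congr frac; apply: val_inj; rewrite /= mulg1.
Qed.

(* S^-1 I, as a subset of S^-1 A. *)
Definition localized_set (I : set A) : set localization :=
  [set y | exists a s, I a /\ y = frac a s].

End Localization.

Arguments localization_map {A} S a.
Arguments localized_set {A} S I _.

(* A subcategory is given by its objects and, among all functions between     *)
(* carriers, its morphisms.                                                   *)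
Record subcategory := Subcategory {
  in_ob : comMonoid0Type -> Prop;
  in_hom : forall A B : comMonoid0Type, (A -> B) -> Prop;
  in_hom_ob : forall (A B : comMonoid0Type) (f : A -> B),
    in_hom f -> in_ob A /\ in_ob B;
  in_hom_morphism : forall (A B : comMonoid0Type) (f : A -> B),
    in_hom f -> monoid0_morphism f;
  in_hom_id : forall A : comMonoid0Type, in_ob A -> in_hom (@id A);
  in_hom_comp : forall (A B C : comMonoid0Type) (g : B -> C) (f : A -> B),
    in_hom g -> in_hom f -> in_hom (g \o f)
}.

Lemma monoid0_morphism_id (A : comMonoid0Type) : monoid0_morphism (@id A).
Proof. by []. Qed.

Lemma monoid0_morphism_comp (A B C : comMonoid0Type) (g : B -> C) (f : A -> B) :
  monoid0_morphism g -> monoid0_morphism f -> monoid0_morphism (g \o f).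
Proof.
move=> [[g1 gM] g0] [[f1 fM] f0]; split=> [|/=]; last by rewrite f0.
by split=> [|x y] /=; rewrite ?f1 ?fM ?gM.
Qed.

Definition all_monoids : subcategory := @Subcategory (fun=> True)
  monoid0_morphism (fun _ _ _ _ => conj I I) (fun _ _ _ f_mor => f_mor)
  (fun A _ => monoid0_morphism_id A) monoid0_morphism_comp.

(* Only the values cl A I with A in M and I an ideal of A are relevant. *)
Definition closure_operation_on (M : subcategory)
    (cl : forall A : comMonoid0Type, set A -> set A) :=
  forall A, in_ob M A -> closure_operation (cl A).

Definition persistent (M : subcategory)
    (cl : forall A : comMonoid0Type, set A -> set A) :=
  closure_operation_on M cl /\
  forall (A B : comMonoid0Type) (f : A -> B), in_hom M f ->
  forall I : set A, is_ideal I -> extend f (cl A I) `<=` cl B (extend f I).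

Definition commutes_with_localization (M : subcategory)
    (cl : forall A : comMonoid0Type, set A -> set A) :=
  persistent M cl /\
  forall (A : comMonoid0Type) (S : mult_set A), in_ob M A ->
  in_hom M (localization_map S) ->
  forall I : set A, is_ideal I ->
    localized_set S (cl A I) = cl (localization S) (localized_set S I).

(* Main.v *)
From mathcomp Require Import all_boot.
From mathcomp Require Import boolp classical_sets.
Require Import Defs.

Set Implicit Arguments.
Unset Strict Implicit.
Unset Printing Implicit Defensive.

Import Algebra.
Local Open Scope classical_set_scope.
Local Open Scope group_scope.

(** Everything comes from two features of a relation [x ^+ n = a * y ^+ n]
    with [y] in the ideal.  It is equational, hence preserved by morphisms and
    by multiplying [x] by a scalar; and it can be raised to any power [m],
    giving exponent [n * m], which lets two such relations, of exponents [n]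
    and [m], be chained into one: this is idempotence.

    For localization, one inclusion is persistence along [A -> S^-1 A].  For
    the other, clearing denominators in [(a/s)^n = (b/t) (y/r)^n] gives a
    relation [u t r^n a^n = u s^n b y^n] in [A].  The coefficient of [a^n] need
    not be an [n]-th power, but multiplying by [(u t)^(n-1)] makes it
    [(u t r)^n], so [u t r a] lies in the Frobenius closure of the ideal, and
    [a/s = (u t r a)/(u t r s)]. *)

Lemma cexpgMn (A : comMonoid0Type) (x y : A) n :
  (x * y) ^+ n = x ^+ n * y ^+ n.
Proof. by apply: expgMn; exact: cmulC. Qed.

Lemma monoid_morphismX (A B : comMonoid0Type) (f : A -> B) :
  monoid_morphism f -> forall x n, f (x ^+ n) = f x ^+ n.
Proof.
by move=> [f1 fM] x; elim=> [|n IHn]; rewrite ?expg0 // !expgS fM IHn.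
Qed.

Section FrobeniusClosure.
Variable A : comMonoid0Type.
Implicit Types I J : set A.

Lemma frob_closure_sub I : I `<=` frob_closure I.
Proof. by move=> x Ix; exists 1%N; split=> //; exists 1, x; rewrite mul1g. Qed.

Lemma frob_closureS I J : I `<=` J -> frob_closure I `<=` frob_closure J.
Proof.
move=> IJ x [n [n0 [a [y [Iy e]]]]].
by exists n; split=> //; exists a, y; split=> //; exact: IJ.
Qed.

Lemma frob_closure_ideal I : is_ideal I -> is_ideal (frob_closure I).
Proof.
move=> [I0 _]; split=> [|x b [n [n0 [a [y [Iy e]]]]]].
  exact: frob_closure_sub.
exists n; split=> //; exists (a * b ^+ n), y; split=> //.
by rewrite cexpgMn e -!mulgA (cmulC (y ^+ n)).
Qed.

(** From [x^n = a y^n] and [y^m = b z^m]: [x^(nm) = a^m b^n z^(nm)]. *)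
Lemma frob_closure_idem I : frob_closure (frob_closure I) = frob_closure I.
Proof.
rewrite eqEsubset; split; last exact: frob_closure_sub.
move=> x [n [n0 [a [y [[m [m0 [b [z [Iz ez]]]]] ey]]]]].
exists (n * m)%N; split; first by rewrite muln_gt0 n0.
exists (a ^+ m * b ^+ n), z; split=> //.
by rewrite expgnA ey cexpgMn -expgnA mulnC expgnA ez cexpgMn -expgnA mulgA.
Qed.

Lemma frob_closure_operation : closure_operation (@frob_closure A).
Proof.
split.
- exact: frob_closure_ideal.
- by move=> I _; exact: frob_closure_sub.
- by move=> I J _ _; exact: frob_closureS.
- by move=> I _; exact: frob_closure_idem.
Qed.

End FrobeniusClosure.

Lemma frob_closure_extend (A B : comMonoid0Type) (f : A -> B) (I : set A) :
  monoid_morphism f -> extend f (frob_closure I) `<=` frob_closure (extend f I).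
Proof.
move=> f_mor _ [x [b [[n [n0 [a [y [Iy e]]]]] ->]]].
exists n; split=> //; exists (f a * b ^+ n), (f y); split.
  by exists y, 1; rewrite mulg1.
rewrite cexpgMn -(monoid_morphismX f_mor) e f_mor.2.
by rewrite (monoid_morphismX f_mor) -!mulgA (cmulC (b ^+ n)).
Qed.

Lemma frob_closure_persistent : persistent all_monoids frob_closure.
Proof.
split=> [A _|A B f [f_mor _] I _]; first exact: frob_closure_operation.
exact: frob_closure_extend.
Qed.

Section Localization.
Variables (A : comMonoid0Type) (S : mult_set A).
Implicit Types (a b : A) (s t : denom S) (I : set A).

Lemma fracM a b s t : frac a s * frac b t = frac (a * b) (denomM s t).
Proof. exact: frac_mulE. Qed.

Fixpoint denomX s n : denom S :=
  if n is m.+1 then denomM s (denomX s m) else denom1 S.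

Lemma denomXE s n : denom_val (denomX s n) = denom_val s ^+ n.
Proof. by elim: n => [|n IHn]; rewrite ?expg0 // expgS denomME IHn. Qed.

Lemma fracX a s n : frac a s ^+ n = frac (a ^+ n) (denomX s n).
Proof. by elim: n => [|n IHn]; rewrite ?expg0 // !expgS IHn fracM. Qed.

Lemma frac_cancel a s t : frac (denom_val t * a) (denomM t s) = frac a s.
Proof.
apply/frac_eqP; exists 1; split; first exact: mult_set1.
by rewrite !mul1g denomME mulgA (cmulC (denom_val s)).
Qed.

(** Reduces one inclusion to persistence: [S^-1 I] is the extension of [I],
    since [a/s = (a/1) (1/s)] and [I] absorbs numerators. *)
Lemma localized_set_extend I :
  is_ideal I -> localized_set S I = extend (localization_map S) I.
Proof.
move=> [_ I_mul]; rewrite eqEsubset; split=> _ [a [s [Ia ->]]].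
  exists a, (frac 1 s); split=> //; rewrite /localization_map fracM mulg1.
  by congr frac; apply: val_inj; rewrite /= mul1g.
rewrite (fracE s) /localization_map fracM.
exists (a * (repr s).1), (denomM (denom1 S) (repr s).2).
by split=> //; exact: I_mul.
Qed.

(** The multiplier [(u t)^(n-1)] completes the coefficient [u t r^n] of [a^n]
    to an [n]-th power; this is where [0 < n] matters. *)
Lemma frob_closure_localized I :
  frob_closure (localized_set S I) `<=` localized_set S (frob_closure I).
Proof.
move=> x [n [n0 [c [_ [[y [r [Iy ->]]] e]]]]].
rewrite (fracE x) (fracE c) !fracX fracM in e *.
case: (repr x) (repr c) e => [a s] [b t] /= /frac_eqP[u [Su]].
rewrite denomME !denomXE => e.
pose w := denomM (Denom Su) t; pose v := denomM w r.
exists (denom_val v * a), (denomM v s); rewrite frac_cancel; split=> //.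
exists n; split=> //.
exists (denom_val w ^+ n.-1 * (u * denom_val s ^+ n * b)), y; split=> //.
have wX : denom_val w ^+ n = denom_val w ^+ n.-1 * (u * denom_val t).
  by rewrite -expgSr prednK.
rewrite cexpgMn (denomME w) cexpgMn wX.
by rewrite -[RHS]mulgA -[X in _ = _ * X]mulgA -e !mulgA.
Qed.

End Localization.

Lemma frob_closure_localization :
  commutes_with_localization all_monoids frob_closure.
Proof.
split=> [|A S _ [loc_mor _] I I_ideal]; first exact: frob_closure_persistent.
rewrite eqEsubset; split; last exact: frob_closure_localized.
rewrite !localized_set_extend //; last exact: frob_closure_ideal.
exact: frob_closure_extend.
Qed.

Theorem proposition4p6 :
  (forall A : comMonoid0Type, closure_operation (@frob_closure A)) /\
  (persistent all_monoids frob_closure /\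
   commutes_with_localization all_monoids frob_closure).
Proof.
split; first exact: frob_closure_operation.
by split; [exact: frob_closure_persistent | exact: frob_closure_localization].
Qed.
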